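(* Let $f(z)=z+a_2z^2+a_3z^3+\cdots$ belong to the class $S^\ast$. Then $$|a_2a_3-a_4|\leq 2.$$ The inequality is sharp: equality is attained by the Koebe function $k(z)=z/(1-z)^2$.
   Context: Let $E=\{z\in\mathbb{C}:|z|<1\}$ be the open unit disk and let $A$ be the class of functions $f(z)=z+a_2z^2+a_3z^3+\cdots$ analytic in $E$. The class $S^\ast$ of starlike functions consists of all $f\in A$ such that $\operatorname{Re}\,\bigl(zf'(z)/f(z)\bigr)>0$ for all $z\in E$ (the quotient being understood as $1$ at $z=0$). *)

(* Defs.v *)
From Stdlib Require Import Reals.
From Coquelicot Require Import Coquelicot.

Open Scope R_scope.

Definition in_disk (z : C) : Prop := Cmod z < 1.

(* Complex differentiability at every point of the open unit disk; the values
   of [f] outside the disk are irrelevant. *)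
Definition analytic_in_disk (f : C -> C) : Prop :=
  forall z : C, in_disk z -> ex_derive (K := C_AbsRing) (V := C_NormedModule) f z.

Definition expansion_in_disk (f : C -> C) (a : nat -> C) : Prop :=
  forall z : C, in_disk z ->
    is_pseries (K := C_AbsRing) (V := C_NormedModule) a z (f z).

Definition class_A (f : C -> C) : Prop :=
  analytic_in_disk f /\
  exists a : nat -> C,
    a 0%nat = RtoC 0 /\ a 1%nat = RtoC 1 /\ expansion_in_disk f a.

(* [C_derive f z] is the complex derivative wherever [f] is complex
   differentiable ([C_derive_correct]). *)
Definition log_derivative_quotient (f : C -> C) (z : C) : C :=
  if Ceq_dec z 0 then RtoC 1 else (z * C_derive f z / f z)%C.

(* Division in [C] is total, so we require explicitly that the quotient is
   defined, i.e. that [f] has no zero in the disk besides the origin. *)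
Definition starlike (f : C -> C) : Prop :=
  class_A f /\
  forall z : C, in_disk z ->
    (z <> RtoC 0 -> f z <> RtoC 0) /\ 0 < Re (log_derivative_quotient f z).

Definition koebe (z : C) : C := (z / (1 - z) ^ 2)%C.

(* Main.v *)
Require Import Defs.
From Stdlib Require Import Reals Lra Lia Classical ClassicalEpsilon.
From Coquelicot Require Import Coquelicot.
Open Scope R_scope.

(** Write [p = z f' / f], a function with positive real part and [p 0 = 1].  Its
    Cayley transform [w = (z f' - f) / (z f' + f)] maps the disk into itself and
    vanishes at [0], so by the lemma of Schwarz [w = z phi] with [|phi| <= 1].
    With [phi = b0 + b1 z + b2 z^2 + ...], comparing coefficients gives
      [a2 = 2 b0],  [a3 = b1 + 3 b0^2],
      [a2 a3 - a4 = (2/3) (3 b0^3 - 2 b0 b1 - b2)].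
    A function bounded by [1] satisfies [|b1| <= 1 - |b0|^2] and
    [|b2| <= 1 - |b0|^2] ([schur_coef_bounds]).  With [s = |b0| <= 1] the
    modulus of the last bracket is therefore at most
      [3 s^3 + 2 s (1 - s^2) + (1 - s^2) = 3 - (1 - s) (2 + s^2)],
    hence at most [3], which is the claim ([starlike_bound]).

    The analysis is done without Cauchy's integral formula.  All functions that
    occur are quotients [N / D] of sums of power series converging in the disk,
    with [D] free of zeros there.  Three facts carry the argument.

    Sums of power series are closed under difference quotients: if [F] has an
    expansion in the disk, then so has [Q], where [F z - F z0 = (z - z0) Q z],
    and [Q z0] is the sum of the differentiated series
    ([difference_quotient]).  This single lemma replaces removability of
    singularities, Taylor expansion at an arbitrary point, termwise
    differentiation and continuity.

    The modulus of a quotient [N / D] obeys the maximum principle, because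
    [|N / D|^2 + e |z|^2] with [e > 0] has no local maximum: its mean over the four
    points [z0 + h], [z0 - h], [z0 + i h], [z0 - i h] exceeds its value at [z0] by
    at least about [e h^2] ([four_point_mean], [quotient_no_local_max]).  With the
    compactness of closed disks this yields the lemma of Schwarz in the
    denominator-free form: [|z N| <= |D|] implies [|N| <= |D|]
    ([schwarz_quotient]).

    The algorithm of Schur, again without denominators, turns a pair with
    [|N| <= |D|] into the pair [(d0 N - n0 D) / z], [conj d0 D - conj n0 N] with the
    same property ([schur_step]); one step bounds [b1], two steps bound [b2].

    For the Koebe function, differentiating the geometric series twice gives its
    coefficients [a_n = n] and the quotient [p = (1 + z) / (1 - z)]. *)

(** * Power series in the unit disk *)

Definition partial_sum (a : nat -> C) (z : C) (n : nat) : C :=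
  sum_n (G := C_AbelianMonoid) (fun k => (z ^ k * a k)%C) n.

Lemma partial_sum_0 (a : nat -> C) (z : C) : partial_sum a z 0 = a 0%nat.
Proof.
unfold partial_sum; rewrite sum_O; simpl; ring.
Qed.

Lemma partial_sum_S (a : nat -> C) (z : C) (n : nat) :
  partial_sum a z (S n) = (partial_sum a z n + z ^ S n * a (S n))%C.
Proof.
unfold partial_sum; rewrite sum_Sn; reflexivity.
Qed.

Definition is_sum (a : nat -> C) (z l : C) : Prop :=
  is_pseries (K := C_AbsRing) (V := C_NormedModule) a z l.

(** Reduces convergence in [C] to real sequences, where squeezing applies. *)
Lemma is_sum_lim (a : nat -> C) (z l : C) :
  is_sum a z l <-> is_lim_seq (fun n => Cmod (partial_sum a z n - l)) 0.
Proof.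
split.
- intros H. apply is_lim_seq_spec; intros eps.
  destruct (proj1 (filterlim_locally_ball_norm (K := C_AbsRing)
    (U := C_NormedModule) _ _) H eps) as [N HN].
  exists N; intros n Hn. specialize (HN n Hn).
  rewrite Rminus_0_r, Rabs_pos_eq; [|apply Cmod_ge_0].
  exact HN.
- intros H. apply is_lim_seq_spec in H.
  apply filterlim_locally_ball_norm; intros eps.
  destruct (H eps) as [N HN]; exists N; intros n Hn.
  specialize (HN n Hn).
  rewrite Rminus_0_r, Rabs_pos_eq in HN; [|apply Cmod_ge_0].
  exact HN.
Qed.

Lemma is_sum_unique (a : nat -> C) (z l1 l2 : C) :
  is_sum a z l1 -> is_sum a z l2 -> l1 = l2.
Proof.
exact (filterlim_locally_unique (K := C_AbsRing) (V := C_NormedModule) _ l1 l2).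
Qed.

Lemma is_sum_ext (a b : nat -> C) (z l : C) :
  (forall n, a n = b n) -> is_sum a z l -> is_sum b z l.
Proof.
intros H; apply is_pseries_ext; exact H.
Qed.

Lemma is_sum_at_0 (a : nat -> C) (l : C) : is_sum a 0 l -> l = a 0%nat.
Proof.
intros H; apply (is_sum_unique a 0); [exact H|].
exact (is_pseries_0 a).
Qed.

Lemma ex_sum_geom (a : nat -> C) (z : C) (M q : R) :
  0 <= q < 1 -> (forall n, Cmod (z ^ n * a n) <= M * q ^ n) ->
  exists l, is_sum a z l.
Proof.
intros Hq Ha.
apply (ex_series_le (K := C_AbsRing) (V := C_CompleteNormedModule)
         (fun n => (z ^ n * a n)%C) (fun n => M * q ^ n)).
- intros n; exact (Ha n).
- apply (ex_series_scal (K := R_AbsRing) (V := R_NormedModule) M (fun n => q ^ n)).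
  apply ex_series_geom; rewrite Rabs_pos_eq; lra.
Qed.

Lemma partial_sum_le_geom (a : nat -> C) (z : C) (M q : R) (n : nat) :
  0 <= q < 1 -> (forall n, Cmod (z ^ n * a n) <= M * q ^ n) ->
  Cmod (partial_sum a z n) <= M / (1 - q).
Proof.
intros Hq Ha.
assert (HM : 0 <= M).
{ specialize (Ha 0%nat); rewrite pow_O, Rmult_1_r in Ha.
  eapply Rle_trans; [apply Cmod_ge_0|exact Ha]. }
assert (H : Cmod (partial_sum a z n) <= M * (1 - q ^ S n) / (1 - q)).
{ induction n as [|n IH].
  - generalize (Ha 0%nat); unfold partial_sum; rewrite sum_O.
    replace (M * (1 - q ^ 1) / (1 - q)) with (M * q ^ 0) by (simpl; field; lra).
    trivial.
  - rewrite partial_sum_S.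
    eapply Rle_trans; [apply Cmod_triangle|].
    replace (M * (1 - q ^ S (S n)) / (1 - q))
      with (M * (1 - q ^ S n) / (1 - q) + M * q ^ S n) by (simpl; field; lra).
    apply Rplus_le_compat; [exact IH|apply Ha]. }
eapply Rle_trans; [exact H|].
apply Rmult_le_compat_r; [left; apply Rinv_0_lt_compat; lra|].
assert (0 <= q ^ S n) by (apply pow_le; lra).
nra.
Qed.

Lemma is_sum_le_geom (a : nat -> C) (z l : C) (M q : R) :
  0 <= q < 1 -> (forall n, Cmod (z ^ n * a n) <= M * q ^ n) ->
  is_sum a z l -> Cmod l <= M / (1 - q).
Proof.
intros Hq Ha Hl. apply is_sum_lim in Hl.
cut (Cmod l <= M / (1 - q) + 0); [lra|].
apply (is_lim_seq_le (fun _ => Cmod l)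
   (fun n => M / (1 - q) + Cmod (partial_sum a z n - l)) (Cmod l) (M / (1 - q) + 0)).
- intros n.
  replace l with (partial_sum a z n + - (partial_sum a z n - l))%C at 1 by ring.
  eapply Rle_trans; [apply Cmod_triangle|]. rewrite Cmod_opp.
  apply Rplus_le_compat_r, partial_sum_le_geom; assumption.
- apply is_lim_seq_const.
- apply is_lim_seq_plus'; [apply is_lim_seq_const|exact Hl].
Qed.

Lemma Cmod_pow_mult (z w : C) (n : nat) : Cmod (z ^ n * w) = Cmod z ^ n * Cmod w.
Proof.
rewrite Cmod_mult, Cmod_pow; reflexivity.
Qed.

(** The estimates of Cauchy for all radii below [1]; they characterise the
    coefficient sequences of power series converging in the unit disk
    ([expansion_Cauchy_bounded], [Cauchy_bounded_expansion]). *)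
Definition Cauchy_bounded (a : nat -> C) : Prop :=
  forall rho : R, 0 < rho < 1 -> exists M : R, forall n, Cmod (a n) * rho ^ n <= M.

Definition disk_sum (a : nat -> C) (z : C) : C :=
  iota (T := CompleteNormedModule.CompleteSpace _ C_CompleteNormedModule) (fun l => is_sum a z l).

Lemma expansion_Cauchy_bounded (F : C -> C) (a : nat -> C) :
  expansion_in_disk F a -> Cauchy_bounded a.
Proof.
intros HF rho Hrho.
assert (Hin : in_disk rho).
{ unfold in_disk; rewrite Cmod_R, Rabs_pos_eq; lra. }
specialize (HF rho Hin).
destruct (filterlim_bounded (K := C_AbsRing) (V := C_NormedModule)
            (partial_sum a rho)) as [M HM].
{ exists (F rho); exact HF. }
assert (HM' : forall n, Cmod (partial_sum a rho n) <= M) by exact HM.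
exists (2 * M); intros n.
replace (Cmod (a n) * rho ^ n) with (Cmod (RtoC rho ^ n * a n)).
2:{ rewrite Cmod_pow_mult, Cmod_R, Rabs_pos_eq; [ring|lra]. }
destruct n as [|n].
- generalize (HM' 0%nat) (Cmod_ge_0 (partial_sum a rho 0)).
  rewrite partial_sum_0. simpl. rewrite Cmult_1_l. lra.
- replace (RtoC rho ^ S n * a (S n))%C
    with (partial_sum a rho (S n) + - partial_sum a rho n)%C
    by (rewrite partial_sum_S; ring).
  eapply Rle_trans; [apply Cmod_triangle|]. rewrite Cmod_opp.
  generalize (HM' n) (HM' (S n)); lra.
Qed.

(** Comparison with the geometric series of ratio [r / rho]; the intermediate
    radius [(1 + |z|) / 2] is the usual choice of [rho] below. *)
Lemma term_le_geom (a : nat -> C) (z : C) (M r rho : R) :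
  0 < rho -> Cmod z <= r -> (forall n, Cmod (a n) * rho ^ n <= M) ->
  forall n, Cmod (z ^ n * a n) <= M * (r / rho) ^ n.
Proof.
intros Hrho Hz HM n.
rewrite Cmod_pow_mult.
assert (Hp : 0 < rho ^ n) by (apply pow_lt; lra).
assert (Hz' : Cmod z ^ n <= r ^ n).
{ apply pow_incr; split; [apply Cmod_ge_0|exact Hz]. }
unfold Rdiv; rewrite Rpow_mult_distr, pow_inv.
replace (M * (r ^ n * / rho ^ n)) with (r ^ n * (M * / rho ^ n)) by ring.
apply Rmult_le_compat; [apply pow_le, Cmod_ge_0|apply Cmod_ge_0|exact Hz'|].
apply (Rmult_le_reg_r (rho ^ n)); [exact Hp|].
replace (M * / rho ^ n * rho ^ n) with M by (field; lra).
apply HM.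
Qed.

Lemma ratio_lt_1 (r rho : R) : 0 <= r < rho -> 0 <= r / rho < 1.
Proof.
intros H; split.
- apply Rmult_le_pos; [lra|left; apply Rinv_0_lt_compat; lra].
- apply (Rmult_lt_reg_r rho); [lra|]. unfold Rdiv.
  rewrite Rmult_assoc, Rinv_l; lra.
Qed.

Lemma Cauchy_bounded_expansion (a : nat -> C) :
  Cauchy_bounded a -> expansion_in_disk (disk_sum a) a.
Proof.
intros Ha z Hz. unfold in_disk in Hz.
assert (Hz0 := Cmod_ge_0 z).
destruct (Ha ((1 + Cmod z) / 2)) as [M HM]; [lra|].
destruct (ex_sum_geom a z M (Cmod z / ((1 + Cmod z) / 2))) as [l Hl].
{ apply ratio_lt_1; lra. }
{ apply term_le_geom; [lra|apply Rle_refl|exact HM]. }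
unfold disk_sum.
apply (@iota_correct C_AbsRing C_CompleteNormedModule (fun l => is_sum a z l)).
exists l; split; [exact Hl|].
intros l' Hl'; exact (is_sum_unique a z l l' Hl Hl').
Qed.

Lemma expansion_bounded (F : C -> C) (a : nat -> C) (r : R) :
  expansion_in_disk F a -> r < 1 ->
  exists K, 0 < K /\ forall z, Cmod z <= r -> Cmod (F z) <= K.
Proof.
intros HF Hr.
destruct (Rlt_or_le r 0) as [Hr0|Hr0].
{ exists 1; split; [lra|]. intros z Hz; generalize (Cmod_ge_0 z); lra. }
destruct (expansion_Cauchy_bounded F a HF ((1 + r) / 2)) as [M HM]; [lra|].
assert (Hq : 0 <= r / ((1 + r) / 2) < 1) by (apply ratio_lt_1; lra).
set (q := r / ((1 + r) / 2)) in *.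
exists (Rabs (M / (1 - q)) + 1); split.
{ generalize (Rabs_pos (M / (1 - q))); lra. }
intros z Hz.
apply Rle_trans with (M / (1 - q)).
- apply (is_sum_le_geom a z _ M q Hq).
  + unfold q; apply term_le_geom; [lra|exact Hz|exact HM].
  + apply HF; unfold in_disk; lra.
- generalize (Rle_abs (M / (1 - q))); lra.
Qed.

(** * Difference quotients of power series *)

Lemma is_lim_seq_0_squeeze (u v : nat -> R) :
  (forall n, 0 <= u n <= v n) -> is_lim_seq v 0 -> is_lim_seq u 0.
Proof.
intros H Hv; apply (is_lim_seq_le_le (fun _ => 0) u v); [exact H| |exact Hv].
apply is_lim_seq_const.
Qed.

Lemma is_lim_seq_const_pow (M q : R) :
  0 <= q < 1 -> is_lim_seq (fun n => M * q ^ n) 0.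
Proof.
intros Hq. replace 0 with (M * 0) by ring.
apply (is_lim_seq_scal_l (fun n => q ^ n) M 0).
apply is_lim_seq_geom; rewrite Rabs_pos_eq; lra.
Qed.

(** Bernoulli's inequality bounds [n] by a multiple of [(1 + x)^n]; with
    [x = (1 - q) / 2] the product [q (1 + x)] stays below [1]. *)
Lemma linear_pow_le (q : R) :
  0 <= q < 1 ->
  exists K q', 0 < K /\ 0 <= q' < 1 /\ forall n, INR (S n) * q ^ n <= K * q' ^ n.
Proof.
intros Hq. set (x := (1 - q) / 2).
exists (1 / x + 1), (q * (1 + x)).
assert (Hx : 0 < x) by (unfold x; lra).
assert (Hx' : 0 < / x) by (apply Rinv_0_lt_compat; exact Hx).
repeat split.
- unfold Rdiv; lra.
- apply Rmult_le_pos; lra.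
- unfold x; nra.
- intros n. rewrite Rpow_mult_distr, S_INR.
  assert (Hp := poly n x Hx).
  assert (Hq' : 0 <= q ^ n) by (apply pow_le; lra).
  assert (Hn : INR n + 1 <= (1 / x + 1) * (1 + x) ^ n).
  { assert (0 <= INR n) by apply pos_INR.
    apply Rle_trans with ((1 / x + 1) * (1 + INR n * x)).
    - replace ((1 / x + 1) * (1 + INR n * x))
        with (INR n + 1 + / x + INR n * x) by (field; lra).
      assert (0 <= INR n * x) by (apply Rmult_le_pos; lra). lra.
    - apply Rmult_le_compat_l; [unfold Rdiv; lra|exact Hp]. }
  replace ((1 / x + 1) * (q ^ n * (1 + x) ^ n))
    with (((1 / x + 1) * (1 + x) ^ n) * q ^ n) by ring.
  apply Rmult_le_compat_r; assumption.
Qed.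

Lemma is_lim_seq_linear_pow (M q : R) :
  0 <= M -> 0 <= q < 1 -> is_lim_seq (fun n => INR (S n) * (M * q ^ n)) 0.
Proof.
intros HM Hq. destruct (linear_pow_le q Hq) as (K & q' & HK & Hq' & H).
apply is_lim_seq_0_squeeze with (fun n => (M * K) * q' ^ n).
- intros n; split.
  + apply Rmult_le_pos; [apply pos_INR|].
    apply Rmult_le_pos; [exact HM|apply pow_le; lra].
  + specialize (H n).
    replace (INR (S n) * (M * q ^ n)) with (M * (INR (S n) * q ^ n)) by ring.
    rewrite Rmult_assoc. apply Rmult_le_compat_l; assumption.
- apply is_lim_seq_const_pow; exact Hq'.
Qed.

Lemma Cauchy_bounded_shift (a : nat -> C) (m : nat) :
  Cauchy_bounded a -> Cauchy_bounded (fun j => a (m + j)%nat).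
Proof.
intros Ha rho Hrho; destruct (Ha rho Hrho) as [M HM].
exists (M / rho ^ m); intros n.
assert (0 < rho ^ m) by (apply pow_lt; lra).
apply (Rmult_le_reg_r (rho ^ m)); [assumption|].
replace (M / rho ^ m * rho ^ m) with M by (field; lra).
rewrite Rmult_assoc, <- pow_add, Nat.add_comm. apply HM.
Qed.

(** The sum of [a_(m+j) z^j] over [j]. *)
Definition tail_sum (a : nat -> C) (z : C) (m : nat) : C :=
  disk_sum (fun j => a (m + j)%nat) z.

(** Coefficients of the difference quotient of [F] at [z]: dividing
    [x^n - z^n] by [x - z] and collecting the powers of [x] gives
    [sum_j a_(m+1+j) z^j] as the coefficient of [x^m]. *)
Definition quotient_coef (a : nat -> C) (z : C) (m : nat) : C := tail_sum a z (S m).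

Lemma tail_sum_correct (a : nat -> C) (z : C) (m : nat) :
  Cauchy_bounded a -> in_disk z -> is_sum (fun j => a (m + j)%nat) z (tail_sum a z m).
Proof.
intros Ha Hz.
exact (Cauchy_bounded_expansion _ (Cauchy_bounded_shift a m Ha) z Hz).
Qed.

Lemma is_sum_unshift (a : nat -> C) (z l : C) :
  is_sum (fun n => a (S n)) z l -> is_sum a z (a 0%nat + z * l).
Proof.
intros H. apply is_sum_lim in H. apply is_sum_lim.
apply is_lim_seq_incr_1.
apply is_lim_seq_0_squeeze with (fun n => Cmod z * Cmod (partial_sum (fun n => a (S n)) z n - l)).
- intros n; split; [apply Cmod_ge_0|].
  rewrite <- Cmod_mult. right; f_equal.
  induction n as [|n IH].
  + rewrite partial_sum_S, !partial_sum_0; simpl; ring.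
  + rewrite partial_sum_S.
    replace (z * (partial_sum (fun n0 => a (S n0)) z (S n) - l))%C
      with (z * (partial_sum (fun n0 => a (S n0)) z n - l)
            + z ^ S (S n) * a (S (S n)))%C
      by (rewrite partial_sum_S; simpl; ring).
    rewrite <- IH. simpl; ring.
- replace 0 with (Cmod z * 0) by ring.
  apply (is_lim_seq_scal_l _ (Cmod z) 0); exact H.
Qed.

(** This first order recurrence is all that the telescoping identities
    [partial_sum_quotient] and [partial_sum_quotient_diag] use, so no double
    series has to be rearranged. *)
Lemma tail_sum_rec (a : nat -> C) (z : C) (m : nat) :
  Cauchy_bounded a -> in_disk z ->
  tail_sum a z m = (a m + z * tail_sum a z (S m))%C.
Proof.
intros Ha Hz.
apply (is_sum_unique (fun j => a (m + j)%nat) z).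
- apply tail_sum_correct; assumption.
- assert (H := is_sum_unshift (fun j => a (m + j)%nat) z (tail_sum a z (S m))).
  cbv beta in H; rewrite Nat.add_0_r in H. apply H.
  apply (is_sum_ext (fun j => a (S m + j)%nat)).
  { intros j; f_equal; lia. }
  apply tail_sum_correct; assumption.
Qed.

Lemma tail_sum_bound (a : nat -> C) (z : C) (rho : R) :
  Cauchy_bounded a -> Cmod z < rho < 1 ->
  exists M, 0 <= M /\ forall m, Cmod (tail_sum a z m) * rho ^ m <= M.
Proof.
intros Ha Hrho. assert (Hz := Cmod_ge_0 z).
destruct (Ha rho) as [M HM]; [lra|].
assert (HM0 : 0 <= M).
{ eapply Rle_trans; [|apply (HM 0%nat)].
  apply Rmult_le_pos; [apply Cmod_ge_0|apply pow_le; lra]. }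
assert (Hq : 0 <= Cmod z / rho < 1) by (apply ratio_lt_1; lra).
set (q := Cmod z / rho) in *.
exists (M / (1 - q)); split.
{ apply Rmult_le_pos; [exact HM0|left; apply Rinv_0_lt_compat; lra]. }
intros m.
assert (Hm : 0 < rho ^ m) by (apply pow_lt; lra).
assert (Hb : Cmod (tail_sum a z m) <= (M / rho ^ m) / (1 - q)).
{ apply (is_sum_le_geom (fun j => a (m + j)%nat) z _ _ q Hq).
  - unfold q; apply term_le_geom; [lra|lra|].
    intros n. apply (Rmult_le_reg_r (rho ^ m)); [assumption|].
    replace (M / rho ^ m * rho ^ m) with M by (field; lra).
    rewrite Rmult_assoc, <- pow_add, Nat.add_comm. apply HM.
  - apply tail_sum_correct; [exact Ha|unfold in_disk; lra]. }
apply Rle_trans with ((M / rho ^ m) / (1 - q) * rho ^ m).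
- apply Rmult_le_compat_r; [lra|exact Hb].
- right; field; lra.
Qed.

Lemma quotient_coef_bounded (a : nat -> C) (z0 : C) :
  Cauchy_bounded a -> in_disk z0 -> Cauchy_bounded (quotient_coef a z0).
Proof.
intros Ha Hz rho Hrho. unfold in_disk in Hz.
assert (H0 := Cmod_ge_0 z0).
set (s := Rmax rho ((1 + Cmod z0) / 2)).
assert (Hs : Cmod z0 < s < 1 /\ rho <= s).
{ split; [split|].
  - apply Rlt_le_trans with ((1 + Cmod z0) / 2); [lra|apply Rmax_r].
  - apply Rmax_lub_lt; lra.
  - apply Rmax_l. }
destruct (tail_sum_bound a z0 s Ha) as (M & HM0 & HM); [lra|].
exists (M / s); intros n.
apply (Rmult_le_reg_r s); [lra|].
replace (M / s * s) with M by (field; lra).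
eapply Rle_trans; [|apply (HM (S n))].
unfold quotient_coef; simpl pow.
rewrite (Rmult_comm s (s ^ n)), <- Rmult_assoc.
apply Rmult_le_compat_r; [lra|].
apply Rmult_le_compat_l; [apply Cmod_ge_0|].
apply pow_incr; lra.
Qed.

Lemma partial_sum_quotient (a : nat -> C) (z0 z : C) (n : nat) :
  Cauchy_bounded a -> in_disk z0 ->
  ((z - z0) * partial_sum (quotient_coef a z0) z n
   = partial_sum a z n - tail_sum a z0 0 + z ^ S n * quotient_coef a z0 n)%C.
Proof.
intros Ha Hz. induction n as [|n IH].
- rewrite !partial_sum_0, (tail_sum_rec a z0 0 Ha Hz).
  unfold quotient_coef. simpl. ring.
- rewrite !partial_sum_S, Cmult_plus_distr_l, IH.
  unfold quotient_coef. rewrite (tail_sum_rec a z0 (S n) Ha Hz).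
  simpl. ring.
Qed.

Definition deriv_coef (a : nat -> C) (n : nat) : C := (RtoC (INR (S n)) * a (S n))%C.

(** Summation by parts: on the diagonal the difference quotient becomes the
    differentiated series, up to a term of the order of [n |z|^n]. *)
Lemma partial_sum_quotient_diag (a : nat -> C) (z : C) (n : nat) :
  Cauchy_bounded a -> in_disk z ->
  (partial_sum (quotient_coef a z) z n
   = RtoC (INR (S n)) * (z ^ S n * quotient_coef a z (S n))
     + partial_sum (deriv_coef a) z n)%C.
Proof.
intros Ha Hz. unfold quotient_coef. induction n as [|n IH].
- rewrite !partial_sum_0, (tail_sum_rec a z 1 Ha Hz).
  unfold deriv_coef. simpl. ring.
- rewrite !partial_sum_S, IH, (tail_sum_rec a z (S (S n)) Ha Hz).
  unfold deriv_coef. rewrite (S_INR (S n)), RtoC_plus. simpl Cpow. ring.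
Qed.

Lemma Cauchy_bounded_terms (a : nat -> C) (z : C) :
  Cauchy_bounded a -> in_disk z ->
  exists M q, 0 <= M /\ 0 <= q < 1 /\ forall n, Cmod (z ^ n * a n) <= M * q ^ n.
Proof.
intros Ha Hz. unfold in_disk in Hz. assert (H0 := Cmod_ge_0 z).
destruct (Ha ((1 + Cmod z) / 2)) as [M HM]; [lra|].
exists M, (Cmod z / ((1 + Cmod z) / 2)); split; [|split].
- eapply Rle_trans; [|apply (HM 0%nat)].
  apply Rmult_le_pos; [apply Cmod_ge_0|apply pow_le; lra].
- apply ratio_lt_1; lra.
- apply term_le_geom; [lra|lra|exact HM].
Qed.

(** Let [n] tend to infinity in [partial_sum_quotient] and in
    [partial_sum_quotient_diag]; the error terms vanish because the coefficients
    of [Q] again satisfy Cauchy's estimates. *)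
Lemma difference_quotient (F : C -> C) (a : nat -> C) (z0 : C) :
  expansion_in_disk F a -> in_disk z0 ->
  let Q := disk_sum (quotient_coef a z0) in
  expansion_in_disk Q (quotient_coef a z0) /\
  (forall z, in_disk z -> F z = (F z0 + (z - z0) * Q z)%C) /\
  is_sum (deriv_coef a) z0 (Q z0).
Proof.
intros HF Hz0 Q.
assert (Ha := expansion_Cauchy_bounded F a HF).
assert (Hb := quotient_coef_bounded a z0 Ha Hz0).
assert (HQ : expansion_in_disk Q (quotient_coef a z0))
  by exact (Cauchy_bounded_expansion _ Hb).
split; [exact HQ|split].
- intros z Hz.
  apply (is_sum_unique a z); [apply HF; exact Hz|].
  assert (Ht : tail_sum a z0 0 = F z0).
  { apply (is_sum_unique a z0); [|apply HF; exact Hz0].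
    exact (tail_sum_correct a z0 0 Ha Hz0). }
  assert (HQz := HQ z Hz). apply is_sum_lim in HQz. apply is_sum_lim.
  destruct (Cauchy_bounded_terms _ z Hb Hz) as (M & q & HM & Hq & HMq).
  apply is_lim_seq_0_squeeze with
    (fun n => Cmod (z - z0) * Cmod (partial_sum (quotient_coef a z0) z n - Q z)
              + (Cmod z * M) * q ^ n).
  + intros n; split; [apply Cmod_ge_0|].
    replace (partial_sum a z n - (F z0 + (z - z0) * Q z))%C with
      ((z - z0) * (partial_sum (quotient_coef a z0) z n - Q z)
       + - (z * (z ^ n * quotient_coef a z0 n)))%C.
    * eapply Rle_trans; [apply Cmod_triangle|].
      rewrite Cmod_opp, (Cmod_mult z), (Cmod_mult (z - z0)), Rmult_assoc.
      apply Rplus_le_compat_l, Rmult_le_compat_l; [apply Cmod_ge_0|apply HMq].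
    * transitivity ((z - z0) * partial_sum (quotient_coef a z0) z n
        - (z - z0) * Q z - z * (z ^ n * quotient_coef a z0 n))%C; [ring|].
      rewrite (partial_sum_quotient a z0 z n Ha Hz0), Ht. simpl; ring.
  + replace 0 with (Cmod (z - z0) * 0 + 0) by ring.
    apply is_lim_seq_plus'; [|apply is_lim_seq_const_pow; exact Hq].
    apply (is_lim_seq_scal_l _ (Cmod (z - z0)) 0); exact HQz.
- assert (HQz := HQ z0 Hz0). apply is_sum_lim in HQz. apply is_sum_lim.
  destruct (Cauchy_bounded_terms _ z0 Hb Hz0) as (M & q & HM & Hq & HMq).
  apply is_lim_seq_0_squeeze with
    (fun n => Cmod (partial_sum (quotient_coef a z0) z0 n - Q z0)
              + INR (S n) * ((M * q) * q ^ n)).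
  + intros n; split; [apply Cmod_ge_0|].
    replace (partial_sum (deriv_coef a) z0 n - Q z0)%C with
      ((partial_sum (quotient_coef a z0) z0 n - Q z0)
       + - (RtoC (INR (S n)) * (z0 ^ S n * quotient_coef a z0 (S n))))%C.
    * eapply Rle_trans; [apply Cmod_triangle|].
      rewrite Cmod_opp, Cmod_mult, Cmod_R, Rabs_pos_eq by apply pos_INR.
      apply Rplus_le_compat_l, Rmult_le_compat_l; [apply pos_INR|].
      eapply Rle_trans; [apply HMq|]. simpl; right; ring.
    * rewrite (partial_sum_quotient_diag a z0 n Ha Hz0). ring.
  + replace 0 with (0 + 0) by ring.
    apply is_lim_seq_plus'; [exact HQz|].
    apply is_lim_seq_linear_pow; [apply Rmult_le_pos; lra|exact Hq].
Qed.

Lemma expansion_lipschitz (F : C -> C) (a : nat -> C) (z0 : C) :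
  expansion_in_disk F a -> in_disk z0 ->
  exists d K, 0 < d /\ 0 < K /\
    forall z, Cmod (z - z0) < d -> in_disk z /\ Cmod (F z - F z0) <= K * Cmod (z - z0).
Proof.
intros HF Hz0. destruct (difference_quotient F a z0 HF Hz0) as (HQ & HFQ & _).
unfold in_disk in Hz0.
destruct (expansion_bounded _ _ ((1 + Cmod z0) / 2) HQ) as (K & HK & HKQ); [lra|].
exists ((1 - Cmod z0) / 2), K; split; [lra|split; [exact HK|]].
intros z Hz.
assert (Hzr : Cmod z <= (1 + Cmod z0) / 2).
{ replace z with (z0 + (z - z0))%C by ring.
  eapply Rle_trans; [apply Cmod_triangle|]. lra. }
assert (Hin : in_disk z) by (unfold in_disk; lra).
split; [exact Hin|].
rewrite (HFQ z Hin).
replace (F z0 + (z - z0) * disk_sum (quotient_coef a z0) z - F z0)%C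
  with ((z - z0) * disk_sum (quotient_coef a z0) z)%C by ring.
rewrite Cmod_mult, Rmult_comm.
apply Rmult_le_compat_r; [apply Cmod_ge_0|apply HKQ; exact Hzr].
Qed.

(** The epsilon-delta form of complex differentiability. *)
Lemma is_derive_C_of_slope (F : C -> C) (z0 l : C) :
  (forall eps : R, 0 < eps -> exists d, 0 < d /\ forall z, Cmod (z - z0) < d ->
     Cmod (F z - F z0 - (z - z0) * l) <= eps * Cmod (z - z0)) ->
  is_derive (K := C_AbsRing) (V := C_NormedModule) F z0 l.
Proof.
intros H. split.
- apply is_linear_scal_l.
- intros x Hx.
  apply (is_filter_lim_locally_unique
    (K := C_AbsRing) (V := AbsRing_NormedModule C_AbsRing)) in Hx; subst x.
  intros eps. destruct (H eps (cond_pos eps)) as (d & Hd & Hz).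
  apply (locally_le_locally_norm (K := C_AbsRing) (V := AbsRing_NormedModule C_AbsRing)).
  exists (mkposreal d Hd); intros z Hball. apply Hz. exact Hball.
Qed.

(** The slope at [z0] is [Q z], which is continuous and equals the sum of the
    differentiated series at [z0]. *)
Lemma expansion_derive (F : C -> C) (a : nat -> C) :
  expansion_in_disk F a ->
  expansion_in_disk (C_derive F) (deriv_coef a) /\
  forall z, in_disk z -> is_derive (K := C_AbsRing) (V := C_NormedModule) F z (C_derive F z).
Proof.
intros HF.
assert (H : forall z0, in_disk z0 -> exists l, is_sum (deriv_coef a) z0 l /\
  is_derive (K := C_AbsRing) (V := C_NormedModule) F z0 l).
{ intros z0 Hz0. destruct (difference_quotient F a z0 HF Hz0) as (HQ & HFQ & Hl).
  eexists; split; [exact Hl|].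
  destruct (expansion_lipschitz _ _ z0 HQ Hz0) as (d & K & Hd & HK & Hlip).
  apply is_derive_C_of_slope. intros eps Heps.
  exists (Rmin d (eps / K)); split.
  { apply Rmin_pos; [exact Hd|]. apply Rdiv_lt_0_compat; assumption. }
  intros z Hz.
  destruct (Hlip z) as [Hin HL].
  { eapply Rlt_le_trans; [exact Hz|apply Rmin_l]. }
  rewrite (HFQ z Hin).
  match goal with |- Cmod ?x <= _ => replace x with
    ((z - z0) * (disk_sum (quotient_coef a z0) z - disk_sum (quotient_coef a z0) z0))%C
    by ring end.
  rewrite Cmod_mult, Rmult_comm. apply Rmult_le_compat_r; [apply Cmod_ge_0|].
  eapply Rle_trans; [exact HL|].
  apply Rle_trans with (K * (eps / K)); [|right; field; lra].
  apply Rmult_le_compat_l; [lra|].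
  left; eapply Rlt_le_trans; [exact Hz|apply Rmin_r]. }
split.
- intros z Hz. destruct (H z Hz) as (l & Hl & Hd).
  rewrite (is_C_derive_unique F z l Hd). exact Hl.
- intros z Hz. destruct (H z Hz) as (l & Hl & Hd).
  rewrite (is_C_derive_unique F z l Hd). exact Hd.
Qed.

(** * Maxima on closed disks *)

Lemma Cmod_le_coord (z w : C) (d : R) :
  Rabs (fst z - fst w) < d -> Rabs (snd z - snd w) < d -> Cmod (z - w) < 2 * d.
Proof.
intros H1 H2.
replace (z - w)%C with (RtoC (fst z - fst w) + Ci * RtoC (snd z - snd w))%C.
2:{ apply injective_projections; simpl; ring. }
eapply Rle_lt_trans; [apply Cmod_triangle|].
rewrite Cmod_mult, Cmod_Ci, !Cmod_R. lra.
Qed.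

Lemma max_of_list {T : Type} (u : T -> R) (l : list T) :
  l <> nil -> exists t, List.In t l /\ forall s, List.In s l -> u s <= u t.
Proof.
induction l as [|x [|y l] IH]; intros Hl; [congruence| |].
- exists x; split; [left; reflexivity|].
  intros s [<-|[]]; lra.
- destruct IH as (t & Ht & Hmax); [congruence|].
  destruct (Rle_dec (u x) (u t)) as [Hxt|Hxt].
  + exists t; split; [right; exact Ht|].
    intros s [<-|Hs]; [exact Hxt|apply Hmax; exact Hs].
  + exists x; split; [left; reflexivity|].
    intros s [<-|Hs]; [lra|]. specialize (Hmax s Hs); lra.
Qed.

(** Compactness of the square with side [2 r], in the form of Cousin's lemma; the
    factor [2] passes from the coordinatewise distance to the modulus.  The
    double negation comes from that lemma and is harmless in the refutation
    where the cover is used. *)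
Lemma closed_disk_cover (r : R) (delta : C -> posreal) :
  ~ ~ exists l : list C, forall z, Cmod z <= r ->
    exists t, List.In t l /\ Cmod (z - t) < 2 * delta t.
Proof.
intros Hn.
apply (compactness_list 2 (- r, (- r, tt)) (r, (r, tt))
  (fun t => delta (fst t, fst (snd t)))).
intros [l Hl]; apply Hn.
exists (List.map (fun t : Compactness.Tn 2 R => (fst t, fst (snd t)) : C) l).
intros z Hz. destruct z as [x y].
assert (Hx := Rmax_Cmod (x, y)); simpl in Hx.
assert (Hx1 := Rmax_l (Rabs x) (Rabs y)).
assert (Hy1 := Rmax_r (Rabs x) (Rabs y)).
destruct (Hl (x, (y, tt))) as ([t1 [t2 []]] & Hin & _ & Hc1 & Hc2 & _).
{ simpl. assert (H1 : Rabs x <= r) by lra. assert (H2 : Rabs y <= r) by lra.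
  apply Rabs_le_between in H1, H2. tauto. }
exists (t1, t2); split.
- apply (List.in_map (fun t : Compactness.Tn 2 R => (fst t, fst (snd t)) : C) l
    (t1, (t2, tt)) Hin).
- apply Cmod_le_coord; assumption.
Qed.

(** If there were no maximum, every point [t] would have a neighbourhood on which
    [u] stays below one fixed value [u w].  Among the finitely many [w] of a finite
    subcover one has the largest [u w]; but that [w] lies in the neighbourhood
    of some centre, whose own value is then larger still. *)
Lemma closed_disk_max (u : C -> R) (r : R) :
  0 <= r ->
  (forall z0, Cmod z0 <= r -> forall e, 0 < e -> exists d, 0 < d /\
     forall z, Cmod (z - z0) < d -> u z < u z0 + e) ->
  exists z0, Cmod z0 <= r /\ forall z, Cmod z <= r -> u z <= u z0.
Proof.
intros Hr Hu. apply NNPP; intros Hno.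
assert (Hbig : forall z0, Cmod z0 <= r -> exists z, Cmod z <= r /\ u z0 < u z).
{ intros z0 Hz0. apply NNPP; intros Hn. apply Hno. exists z0; split; [exact Hz0|].
  intros z Hz. apply Rnot_lt_le; intros Hlt. apply Hn; exists z; tauto. }
assert (Hloc : forall t : C, exists p : posreal * C, Cmod (snd p) <= r /\
  forall z, Cmod z <= r -> Cmod (z - t) < 2 * fst p -> u z < u (snd p)).
{ intros t. destruct (Rle_dec (Cmod t) r) as [Ht|Ht].
  - destruct (Hbig t Ht) as (w & Hw & Huw).
    destruct (Hu t Ht (u w - u t)) as (d & Hd & Hz); [lra|].
    assert (Hd2 : 0 < d / 2) by lra.
    exists (mkposreal _ Hd2, w); split; [exact Hw|]. simpl.
    intros z _ Hzt. specialize (Hz z). lra.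
  - (* the cover may be centred outside the disk: keep such balls disjoint from it *)
    assert (Hd : 0 < (Cmod t - r) / 2) by lra.
    exists (mkposreal _ Hd, RtoC 0); simpl; split; [rewrite Cmod_0; exact Hr|].
    intros z Hz Hzt. exfalso.
    assert (H : Cmod t <= Cmod z + Cmod (z - t)).
    { replace t with (z + - (z - t))%C at 1 by ring.
      eapply Rle_trans; [apply Cmod_triangle|]. rewrite Cmod_opp. lra. }
    lra. }
set (p := fun t => proj1_sig (constructive_indefinite_description _ (Hloc t))).
assert (Hp := fun t => proj2_sig (constructive_indefinite_description _ (Hloc t))).
cbv beta in Hp. change (forall t, Cmod (snd (p t)) <= r /\
  forall z, Cmod z <= r -> Cmod (z - t) < 2 * fst (p t) -> u z < u (snd (p t))) in Hp.
clearbody p.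
apply (closed_disk_cover r (fun t => fst (p t))).
intros [l Hl].
assert (Hl0 : l <> nil).
{ intros ->. destruct (Hl 0) as (t & [] & _). rewrite Cmod_0; exact Hr. }
destruct (max_of_list (fun t => u (snd (p t))) l Hl0) as (t & Ht & Hmax).
destruct (Hp t) as [Htr _].
destruct (Hl (snd (p t)) Htr) as (s & Hs & Hst).
destruct (Hp s) as [_ Hs'].
specialize (Hs' _ Htr Hst). specialize (Hmax s Hs). simpl in Hmax. lra.
Qed.

(** * The maximum principle for quotients *)

Lemma expansion_lin (F G : C -> C) (a b : nat -> C) (c e : C) :
  expansion_in_disk F a -> expansion_in_disk G b ->
  expansion_in_disk (fun z => c * F z + e * G z)%C (fun n => c * a n + e * b n)%C.
Proof.
intros HF HG z Hz.
apply (is_pseries_plus (K := C_AbsRing) (V := C_NormedModule)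
  (fun n => c * a n)%C (fun n => e * b n)%C z).
- apply (is_pseries_scal (K := C_AbsRing) (V := C_NormedModule) c a z).
  + apply Cmult_comm.
  + apply HF; exact Hz.
- apply (is_pseries_scal (K := C_AbsRing) (V := C_NormedModule) e b z).
  + apply Cmult_comm.
  + apply HG; exact Hz.
Qed.

Lemma in_disk_0 : in_disk 0.
Proof. unfold in_disk; rewrite Cmod_0; lra. Qed.

Lemma expansion_at_0 (F : C -> C) (a : nat -> C) :
  expansion_in_disk F a -> F 0 = a 0%nat.
Proof.
intros HF; apply is_sum_at_0, HF, in_disk_0.
Qed.

(** The difference quotient at [0]: a zero of the series at the origin can be
    divided out. *)
Lemma expansion_shift (F : C -> C) (a : nat -> C) :
  expansion_in_disk F a ->
  exists G, expansion_in_disk G (fun n => a (S n)) /\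
    forall z, in_disk z -> F z = (a 0%nat + z * G z)%C.
Proof.
intros HF. destruct (difference_quotient F a 0 HF in_disk_0) as (HQ & HFQ & _).
assert (Ha := expansion_Cauchy_bounded F a HF).
exists (disk_sum (quotient_coef a 0)); split.
- intros z Hz. apply (is_sum_ext (quotient_coef a 0)); [|apply HQ; exact Hz].
  intros n. unfold quotient_coef.
  rewrite (tail_sum_rec a 0 (S n) Ha in_disk_0). ring.
- intros z Hz. rewrite (HFQ z Hz), (expansion_at_0 F a HF). ring.
Qed.

(** One step of the Taylor expansion of [N / D] at [z0].  The remainder has the
    same denominator, so the step can be iterated; its numerator is the
    difference quotient of [N - (N z0 / D z0) D]. *)
Lemma quotient_step (N D : C -> C) (n d : nat -> C) (z0 : C) :
  expansion_in_disk N n -> expansion_in_disk D d ->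
  (forall z, in_disk z -> D z <> 0) -> in_disk z0 ->
  exists N1 n1, expansion_in_disk N1 n1 /\
    forall z, in_disk z -> (N z / D z = N z0 / D z0 + (z - z0) * (N1 z / D z))%C.
Proof.
intros HN HD HD0 Hz0.
destruct (difference_quotient _ _ z0 (expansion_lin N D n d 1 (- (N z0 / D z0)) HN HD) Hz0)
  as (HQ & HFQ & _).
eexists; eexists; split; [exact HQ|].
intros z Hz. specialize (HFQ z Hz).
set (Q := disk_sum _) in *. clearbody Q. clear HQ.
assert (H1 := HD0 z Hz). assert (H2 := HD0 z0 Hz0).
assert (HNz : N z = ((N z0 / D z0) * D z + (z - z0) * Q z)%C).
{ transitivity ((1 * N z + - (N z0 / D z0) * D z) + (N z0 / D z0) * D z)%C; [ring|].
  rewrite HFQ. field. exact H2. }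
rewrite HNz. field. split; assumption.
Qed.

Lemma quotient_lipschitz (N D : C -> C) (n d : nat -> C) (z0 : C) :
  expansion_in_disk N n -> expansion_in_disk D d ->
  (forall z, in_disk z -> D z <> 0) -> in_disk z0 ->
  exists r K, 0 < r /\ 0 < K /\
    forall z, Cmod (z - z0) < r ->
      in_disk z /\ Cmod (N z / D z - N z0 / D z0) <= K * Cmod (z - z0).
Proof.
intros HN HD HD0 Hz0.
destruct (quotient_step N D n d z0 HN HD HD0 Hz0) as (N1 & n1 & HN1 & Hstep).
destruct (expansion_lipschitz N1 n1 z0 HN1 Hz0) as (r1 & K1 & Hr1 & HK1 & HL1).
destruct (expansion_lipschitz D d z0 HD Hz0) as (r2 & K2 & Hr2 & HK2 & HL2).
assert (Hm : 0 < Cmod (D z0)) by (apply Cmod_gt_0, HD0, Hz0).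
set (m := Cmod (D z0)) in *.
assert (Hr3 : 0 < m / (2 * K2)) by (apply Rdiv_lt_0_compat; lra).
assert (HA := Cmod_ge_0 (N1 z0)). set (A := Cmod (N1 z0)) in *.
exists (Rmin r1 (Rmin r2 (m / (2 * K2)))), ((A + K1 * r1 + 1) / (m / 2)).
assert (HB : 0 < A + K1 * r1 + 1) by nra.
split; [|split].
- repeat apply Rmin_pos; assumption.
- apply Rdiv_lt_0_compat; lra.
- intros z Hz.
  assert (Hz1 : Cmod (z - z0) < r1) by (eapply Rlt_le_trans; [exact Hz|apply Rmin_l]).
  assert (Hz2 : Cmod (z - z0) < r2).
  { eapply Rlt_le_trans; [exact Hz|]. eapply Rle_trans; [apply Rmin_r|apply Rmin_l]. }
  assert (Hz3 : Cmod (z - z0) < m / (2 * K2)).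
  { eapply Rlt_le_trans; [exact Hz|]. eapply Rle_trans; [apply Rmin_r|apply Rmin_r]. }
  destruct (HL1 z Hz1) as [Hin H1]. destruct (HL2 z Hz2) as [_ H2].
  split; [exact Hin|]. rewrite (Hstep z Hin).
  replace (N z0 / D z0 + (z - z0) * (N1 z / D z) - N z0 / D z0)%C
    with ((z - z0) * (N1 z / D z))%C by ring.
  rewrite Cmod_mult, Rmult_comm, Cmod_div by (apply HD0; exact Hin).
  apply Rmult_le_compat_r; [apply Cmod_ge_0|].
  assert (HN1z : Cmod (N1 z) <= A + K1 * r1 + 1).
  { replace (N1 z) with (N1 z0 + (N1 z - N1 z0))%C by ring.
    eapply Rle_trans; [apply Cmod_triangle|]. fold A.
    assert (K1 * Cmod (z - z0) <= K1 * r1) by (apply Rmult_le_compat_l; lra). lra. }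
  assert (HDz : m / 2 <= Cmod (D z)).
  { assert (Hm2 : m <= Cmod (D z) + Cmod (D z - D z0)).
    { unfold m. replace (D z0) with (D z + - (D z - D z0))%C at 1 by ring.
      eapply Rle_trans; [apply Cmod_triangle|]. rewrite Cmod_opp. lra. }
    assert (K2 * Cmod (z - z0) <= K2 * (m / (2 * K2))) by (apply Rmult_le_compat_l; lra).
    replace (K2 * (m / (2 * K2))) with (m / 2) in * by (field; lra). lra. }
  unfold Rdiv at 1 2.
  apply Rmult_le_compat; [apply Cmod_ge_0| |exact HN1z|].
  + left; apply Rinv_0_lt_compat; lra.
  + apply Rinv_le_contravar; [lra|exact HDz].
Qed.

(** The cross terms cancel since the sums of [w], of [w^2] and of [w |w|^2] over
    the four points [w] vanish.  This is the discrete form of the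
    subharmonicity of the squared modulus. *)
Lemma four_point_mean (v v1 v2 : C) (h : R) :
  let m w := Cmod (v + w * v1 + w * w * v2) ^ 2 in
  m (RtoC h) + m (- RtoC h)%C + m (Ci * RtoC h)%C + m (- (Ci * RtoC h))%C
  = 4 * (Cmod v ^ 2 + h ^ 2 * Cmod v1 ^ 2 + h ^ 4 * Cmod v2 ^ 2).
Proof.
intros m. unfold m. rewrite !Cmod2_alt.
destruct v as [x y], v1 as [x1 y1], v2 as [x2 y2].
unfold Re, Im, Ci, RtoC, Cmult, Cplus, Copp; simpl. ring.
Qed.

(** Expand [N / D] at [z0] to second order with a remainder of order [h^3] and
    take the mean over four points at distance [h]: the summand [e |z|^2]
    contributes [e h^2], which dominates the remainder. *)
Lemma quotient_no_local_max (N D : C -> C) (n d : nat -> C) (z0 : C) (e r : R) :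
  expansion_in_disk N n -> expansion_in_disk D d ->
  (forall z, in_disk z -> D z <> 0) -> in_disk z0 -> 0 < e -> 0 < r ->
  exists z, Cmod (z - z0) < r /\
    Cmod (N z0 / D z0) ^ 2 + e * Cmod z0 ^ 2 < Cmod (N z / D z) ^ 2 + e * Cmod z ^ 2.
Proof.
intros HN HD HD0 Hz0 He Hr.
destruct (quotient_step N D n d z0 HN HD HD0 Hz0) as (N1 & n1 & HN1 & Hstep1).
destruct (quotient_step N1 D n1 d z0 HN1 HD HD0 Hz0) as (N2 & n2 & HN2 & Hstep2).
destruct (quotient_lipschitz N2 D n2 d z0 HN2 HD HD0 Hz0) as (r2 & K & Hr2 & HK & HL).
set (v := (N z0 / D z0)%C) in *.
set (v1 := (N1 z0 / D z0)%C) in *. set (v2 := (N2 z0 / D z0)%C) in *.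
set (B := Cmod v + Cmod v1 + Cmod v2 + 1).
assert (HB : 1 <= B).
{ unfold B; generalize (Cmod_ge_0 v) (Cmod_ge_0 v1) (Cmod_ge_0 v2); lra. }
assert (HBK : 0 < B * K) by (apply Rmult_lt_0_compat; lra).
(* the last bound makes the remainder cost at most half of the gain [e h^2] *)
set (h := Rmin (Rmin (r / 2) 1) (Rmin (r2 / 2) (e / (4 * (B * K))))).
assert (Hh : 0 < h).
{ unfold h; repeat apply Rmin_pos; try lra. apply Rdiv_lt_0_compat; lra. }
assert (Hh1 : h <= r / 2) by (eapply Rle_trans; [apply Rmin_l|apply Rmin_l]).
assert (Hh2 : h <= 1) by (eapply Rle_trans; [apply Rmin_l|apply Rmin_r]).
assert (Hh3 : h <= r2 / 2) by (eapply Rle_trans; [apply Rmin_r|apply Rmin_l]).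
assert (Hh4 : h <= e / (4 * (B * K))) by (eapply Rle_trans; [apply Rmin_r|apply Rmin_r]).
clearbody h.
assert (Hh5 : h * (B * K) <= e / 4).
{ replace (e / 4) with (e / (4 * (B * K)) * (B * K)) by (field; lra).
  apply Rmult_le_compat_r; lra. }
apply NNPP; intros Hno.
assert (Hle : forall w, Cmod w = h ->
  Cmod (v + w * v1 + w * w * v2) ^ 2 + e * Cmod (z0 + w) ^ 2
  <= Cmod v ^ 2 + e * Cmod z0 ^ 2 + e / 2 * h ^ 2).
{ intros w Hw.
  assert (Hzw : (z0 + w - z0)%C = w) by ring.
  destruct (HL (z0 + w)%C) as [Hin HLw]; [rewrite Hzw, Hw; lra|].
  assert (Hmax : Cmod (N (z0 + w)%C / D (z0 + w)%C) ^ 2 + e * Cmod (z0 + w) ^ 2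
                 <= Cmod v ^ 2 + e * Cmod z0 ^ 2).
  { apply Rnot_lt_le; intros Hlt. apply Hno. exists (z0 + w)%C.
    rewrite Hzw, Hw; split; [lra|exact Hlt]. }
  rewrite (Hstep1 _ Hin), (Hstep2 _ Hin), Hzw in Hmax.
  fold v2 in HLw. rewrite Hzw, Hw in HLw.
  set (p2 := (N2 (z0 + w) / D (z0 + w))%C) in *.
  set (A := (v + w * v1 + w * w * v2)%C).
  replace (v + w * (v1 + w * p2))%C with (A + w * w * (p2 - v2))%C in Hmax
    by (unfold A; ring).
  set (E := (w * w * (p2 - v2))%C) in *.
  assert (HE : Cmod E <= h ^ 2 * (K * h)).
  { unfold E; rewrite !Cmod_mult, Hw. simpl; rewrite Rmult_1_r.
    apply Rmult_le_compat_l; [nra|exact HLw]. }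
  assert (HA : Cmod A <= B).
  { unfold A. eapply Rle_trans; [apply Cmod_triangle|].
    assert (H1 := Cmod_triangle v (w * v1)).
    rewrite Cmod_mult, Hw in H1. rewrite !Cmod_mult, Hw.
    assert (h * Cmod v1 <= 1 * Cmod v1) by (apply Rmult_le_compat_r; [apply Cmod_ge_0|lra]).
    assert (h * h * Cmod v2 <= 1 * Cmod v2) by (apply Rmult_le_compat_r; [apply Cmod_ge_0|nra]).
    unfold B; lra. }
  assert (Htri : Cmod A <= Cmod (A + E) + Cmod E).
  { replace A with ((A + E) + - E)%C at 1 by ring.
    eapply Rle_trans; [apply Cmod_triangle|]. rewrite Cmod_opp; lra. }
  assert (Hsq : Cmod A ^ 2 <= Cmod (A + E) ^ 2 + 2 * Cmod A * Cmod E).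
  { generalize (Cmod_ge_0 A) (Cmod_ge_0 E) (Cmod_ge_0 (A + E)); intros.
    destruct (Rle_lt_dec (Cmod A) (Cmod E)); nra. }
  assert (HAE : 2 * Cmod A * Cmod E <= e / 2 * h ^ 2).
  { apply Rle_trans with (2 * B * (h ^ 2 * (K * h))).
    - apply Rmult_le_compat; try apply Cmod_ge_0; try lra.
      generalize (Cmod_ge_0 A); lra.
    - replace (2 * B * (h ^ 2 * (K * h))) with (2 * (h * (B * K)) * h ^ 2) by ring.
      apply Rmult_le_compat_r; [apply pow_le; lra|lra]. }
  lra. }
assert (Hm := four_point_mean v v1 v2 h). assert (Hz := four_point_mean z0 1 0 h).
cbv zeta in Hm, Hz. rewrite Cmod_1, Cmod_0 in Hz.
assert (Hc : Cmod (RtoC h) = h) by (rewrite Cmod_R, Rabs_pos_eq; lra).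
assert (Hi : Cmod (Ci * RtoC h) = h) by (rewrite Cmod_mult, Cmod_Ci, Hc; ring).
assert (L1 := Hle _ Hc). assert (L2 := Hle (- RtoC h)%C).
assert (L3 := Hle _ Hi). assert (L4 := Hle (- (Ci * RtoC h))%C).
rewrite Cmod_opp in L2, L4. specialize (L2 Hc). specialize (L4 Hi).
assert (Hs : forall w, (z0 + w * 1 + w * w * 0)%C = (z0 + w)%C) by (intros; ring).
rewrite !Hs in Hz.
assert (0 < h ^ 2) by (apply pow_lt; lra).
assert (0 <= h ^ 2 * Cmod v1 ^ 2) by (apply Rmult_le_pos; apply pow_le; [lra|apply Cmod_ge_0]).
assert (0 <= h ^ 4 * Cmod v2 ^ 2) by (apply Rmult_le_pos; apply pow_le; [lra|apply Cmod_ge_0]).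
nra.
Qed.

(** On the circle of radius [1 - s] the hypothesis bounds [|N / D|] by
    [1 / (1 - s)], and [|N / D|^2 + s |z|^2] attains its maximum over the closed
    disk on that circle.  The same small [s] serves as radius defect and as
    coefficient of [|z|^2]; a value of [|N / D|] above [1] is excluded as [s]
    tends to [0]. *)
Lemma schwarz_quotient (N D : C -> C) (n d : nat -> C) :
  expansion_in_disk N n -> expansion_in_disk D d ->
  (forall z, in_disk z -> D z <> 0) ->
  (forall z, in_disk z -> Cmod z * Cmod (N z) <= Cmod (D z)) ->
  forall z, in_disk z -> Cmod (N z) <= Cmod (D z).
Proof.
intros HN HD HD0 Hle z1 Hz1.
assert (HD1 : 0 < Cmod (D z1)) by (apply Cmod_gt_0, HD0, Hz1).
apply Rnot_lt_le; intros Hlt.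
set (X := Cmod (N z1 / D z1) ^ 2).
assert (HX : 1 < X).
{ assert (H : 1 < Cmod (N z1 / D z1)).
  { rewrite Cmod_div by (apply HD0; exact Hz1).
    apply (Rmult_lt_reg_r (Cmod (D z1))); [exact HD1|].
    replace (Cmod (N z1) / Cmod (D z1) * Cmod (D z1)) with (Cmod (N z1)) by (field; lra).
    lra. }
  unfold X; simpl; nra. }
assert (Hz1' := Hz1). unfold in_disk in Hz1'. assert (H0 := Cmod_ge_0 z1).
set (s := Rmin ((1 - Cmod z1) / 2) ((X - 1) / (2 * (1 + 2 * X)))).
assert (Hs : 0 < s).
{ unfold s; apply Rmin_pos; [lra|apply Rdiv_lt_0_compat; lra]. }
assert (Hs1 : s <= (1 - Cmod z1) / 2) by apply Rmin_l.
assert (Hs2 : s * (1 + 2 * X) <= (X - 1) / 2).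
{ replace ((X - 1) / 2) with ((X - 1) / (2 * (1 + 2 * X)) * (1 + 2 * X)) by (field; lra).
  apply Rmult_le_compat_r; [lra|apply Rmin_r]. }
clearbody s.
destruct (closed_disk_max (fun z => Cmod (N z / D z) ^ 2 + s * Cmod z ^ 2) (1 - s))
  as (z0 & Hz0 & Hmax); [lra| |].
{ intros z0 Hz0 e He.
  assert (Hin0 : in_disk z0) by (unfold in_disk; lra).
  destruct (quotient_lipschitz N D n d z0 HN HD HD0 Hin0) as (r & K & Hr & HK & HL).
  set (A := Cmod (N z0 / D z0)) in *. assert (HA : 0 <= A) by apply Cmod_ge_0.
  set (L := 2 * A * K + K * K + s * 3 + 1).
  assert (HLpos : 0 < L) by (unfold L; nra).
  assert (He' : 0 < e / L) by (apply Rdiv_lt_0_compat; assumption).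
  exists (Rmin r (Rmin 1 (e / L))); split; [repeat apply Rmin_pos; lra|].
  intros z Hz.
  assert (Hz2 : Cmod (z - z0) < r) by (eapply Rlt_le_trans; [exact Hz|apply Rmin_l]).
  assert (Hz3 : Cmod (z - z0) < 1).
  { eapply Rlt_le_trans; [exact Hz|]. eapply Rle_trans; [apply Rmin_r|apply Rmin_l]. }
  assert (Hz4 : Cmod (z - z0) < e / L).
  { eapply Rlt_le_trans; [exact Hz|]. eapply Rle_trans; [apply Rmin_r|apply Rmin_r]. }
  destruct (HL z Hz2) as [_ HLz].
  assert (Hh := Cmod_ge_0 (z - z0)). set (h := Cmod (z - z0)) in *.
  assert (Hq : Cmod (N z / D z) <= A + K * h).
  { replace (N z / D z)%C with (N z0 / D z0 + (N z / D z - N z0 / D z0))%C by ring.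
    eapply Rle_trans; [apply Cmod_triangle|]. fold A; lra. }
  assert (Hzz : Cmod z <= Cmod z0 + h).
  { replace z with (z0 + (z - z0))%C at 1 by ring. apply Cmod_triangle. }
  assert (HLe : h * L < e).
  { replace e with (e / L * L) by (field; lra). apply Rmult_lt_compat_r; assumption. }
  assert (Hq2 : Cmod (N z / D z) ^ 2 <= (A + K * h) ^ 2)
    by (apply pow_incr; split; [apply Cmod_ge_0|exact Hq]).
  assert (Hzz2 : Cmod z ^ 2 <= (Cmod z0 + h) ^ 2)
    by (apply pow_incr; split; [apply Cmod_ge_0|exact Hzz]).
  assert (Hb1 : (A + K * h) ^ 2 <= A ^ 2 + h * (2 * A * K + K * K)).
  { assert (h * h <= h * 1) by (apply Rmult_le_compat_l; lra).
    assert (K * K * (h * h) <= K * K * h) by (apply Rmult_le_compat_l; nra).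
    nra. }
  assert (Hb2 : (Cmod z0 + h) ^ 2 <= Cmod z0 ^ 2 + h * 3).
  { generalize (Cmod_ge_0 z0); nra. }
  unfold L in HLe. nra. }
assert (Hin0 : in_disk z0) by (unfold in_disk; lra).
destruct (Rle_lt_or_eq_dec _ _ Hz0) as [Hint|Hbd].
- destruct (quotient_no_local_max N D n d z0 s (1 - s - Cmod z0) HN HD HD0 Hin0 Hs)
    as (z & Hz & Hbig); [lra|].
  assert (Cmod z <= 1 - s).
  { replace z with (z0 + (z - z0))%C by ring.
    eapply Rle_trans; [apply Cmod_triangle|]. lra. }
  specialize (Hmax z H). lra.
- assert (Hm1 := Hmax z1 ltac:(lra)). fold X in Hm1.
  assert (HD2 : 0 < Cmod (D z0)) by (apply Cmod_gt_0, HD0, Hin0).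
  assert (Hq : (1 - s) * Cmod (N z0 / D z0) <= 1).
  { rewrite Cmod_div by (apply HD0; exact Hin0). rewrite <- Hbd.
    apply (Rmult_le_reg_r (Cmod (D z0))); [exact HD2|].
    replace (Cmod z0 * (Cmod (N z0) / Cmod (D z0)) * Cmod (D z0))
      with (Cmod z0 * Cmod (N z0)) by (field; lra).
    generalize (Hle z0 Hin0); lra. }
  assert (Hq2 : (1 - s) ^ 2 * Cmod (N z0 / D z0) ^ 2 <= 1).
  { rewrite <- Rpow_mult_distr.
    assert (0 <= (1 - s) * Cmod (N z0 / D z0)) by (apply Rmult_le_pos; [lra|apply Cmod_ge_0]).
    nra. }
  rewrite Hbd in Hm1.
  assert (HXs : X <= Cmod (N z0 / D z0) ^ 2 + s * (1 - s) ^ 2).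
  { assert (0 <= s * Cmod z1 ^ 2) by (apply Rmult_le_pos; [lra|apply pow_le; lra]). lra. }
  assert (H1s : 0 <= (1 - s) ^ 2 <= 1) by nra.
  assert (HX2 : (1 - s) ^ 2 * X <= 1 + s).
  { apply Rle_trans with ((1 - s) ^ 2 * (Cmod (N z0 / D z0) ^ 2 + s * (1 - s) ^ 2)).
    - apply Rmult_le_compat_l; lra.
    - assert (s * (1 - s) ^ 2 <= s * 1) by (apply Rmult_le_compat_l; lra).
      assert (0 <= s * (1 - s) ^ 2) by (apply Rmult_le_pos; lra).
      nra. }
  nra.
Qed.

(** * The algorithm of Schur *)

(** [n] and [d] are the coefficients of numerator and denominator of a function
    bounded by [1].  Keeping the pair avoids products and inverses of series. *)
Definition schur_pair (n d : nat -> C) : Prop :=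
  exists N D : C -> C,
    expansion_in_disk N n /\ expansion_in_disk D d /\
    (forall z, in_disk z -> D z <> 0) /\
    (forall z, in_disk z -> Cmod (N z) <= Cmod (D z)).

Lemma schur_pair_0 (n d : nat -> C) :
  schur_pair n d -> d 0%nat <> 0 /\ Cmod (n 0%nat) <= Cmod (d 0%nat).
Proof.
intros (N & D & HN & HD & HD0 & Hle).
rewrite <- (expansion_at_0 N n HN), <- (expansion_at_0 D d HD).
split; [apply HD0, in_disk_0|apply Hle, in_disk_0].
Qed.

Lemma schur_pair_scal (n d : nat -> C) (t : R) :
  0 <= t <= 1 -> schur_pair n d -> schur_pair (fun k => RtoC t * n k)%C d.
Proof.
intros Ht (N & D & HN & HD & HD0 & Hle).
exists (fun z => RtoC t * N z)%C, D.
split; [|split; [exact HD|split; [exact HD0|]]].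
- intros z Hz.
  apply (is_pseries_scal (K := C_AbsRing) (V := C_NormedModule) (RtoC t) n z).
  + apply Cmult_comm.
  + apply HN; exact Hz.
- intros z Hz. rewrite Cmod_mult, Cmod_R, Rabs_pos_eq by lra.
  generalize (Hle z Hz) (Cmod_ge_0 (N z)); intros; nra.
Qed.

(** The identity behind the fact that Moebius maps preserve the unit disk. *)
Lemma Cmod_mobius (p q x y : C) :
  Cmod (Cconj p * y - Cconj q * x) ^ 2 - Cmod (p * x - q * y) ^ 2
  = (Cmod p ^ 2 - Cmod q ^ 2) * (Cmod y ^ 2 - Cmod x ^ 2).
Proof.
rewrite !Cmod2_alt. destruct p, q, x, y.
unfold Re, Im, Cconj, Cmult, Cminus, Cplus, Copp; simpl. ring.
Qed.

(** With [phi = N / D] and [c = n0 / d0], the new quotient is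
    [(phi - c) / (z (1 - conj c phi))] up to a unimodular constant.  It is bounded by
    [1] by the lemma of Schwarz; [|n0| < |d0|] keeps its denominator free of
    zeros. *)
Lemma schur_step (n d : nat -> C) :
  schur_pair n d -> Cmod (n 0%nat) < Cmod (d 0%nat) ->
  schur_pair (fun k => d 0%nat * n (S k) - n 0%nat * d (S k))%C
             (fun k => Cconj (d 0%nat) * d k - Cconj (n 0%nat) * n k)%C.
Proof.
intros (N & D & HN & HD & HD0 & Hle) Hlt.
set (n0 := n 0%nat) in *. set (d0 := d 0%nat) in *.
assert (HF : expansion_in_disk (fun z => d0 * N z - n0 * D z)%C
                               (fun k => d0 * n k - n0 * d k)%C).
{ intros z Hz.
  replace (d0 * N z - n0 * D z)%C with (d0 * N z + - n0 * D z)%C by ring.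
  apply (is_sum_ext (fun k => d0 * n k + - n0 * d k)%C); [intros k; ring|].
  apply (expansion_lin N D n d d0 (- n0)%C HN HD z Hz). }
assert (HD2 : expansion_in_disk (fun z => Cconj d0 * D z - Cconj n0 * N z)%C
                                (fun k => Cconj d0 * d k - Cconj n0 * n k)%C).
{ intros z Hz.
  replace (Cconj d0 * D z - Cconj n0 * N z)%C
    with (Cconj d0 * D z + - Cconj n0 * N z)%C by ring.
  apply (is_sum_ext (fun k => Cconj d0 * d k + - Cconj n0 * n k)%C); [intros k; ring|].
  apply (expansion_lin D N d n (Cconj d0) (- Cconj n0)%C HD HN z Hz). }
destruct (expansion_shift _ _ HF) as (N2 & HN2 & HFN2).
assert (Hnz : forall z, in_disk z -> (Cconj d0 * D z - Cconj n0 * N z)%C <> 0).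
{ intros z Hz Heq.
  assert (HE : (Cconj d0 * D z)%C = (Cconj n0 * N z)%C).
  { replace (Cconj d0 * D z)%C
      with ((Cconj d0 * D z - Cconj n0 * N z) + Cconj n0 * N z)%C by ring.
    rewrite Heq; ring. }
  apply (f_equal Cmod) in HE. rewrite !Cmod_mult, !Cmod_conj in HE.
  assert (0 < Cmod (D z)) by (apply Cmod_gt_0, HD0, Hz).
  generalize (Hle z Hz) (Cmod_ge_0 (N z)) (Cmod_ge_0 n0); intros. nra. }
exists N2, (fun z => Cconj d0 * D z - Cconj n0 * N z)%C.
split; [exact HN2|split; [exact HD2|split; [exact Hnz|]]].
apply (schwarz_quotient N2 _ _ _ HN2 HD2 Hnz).
intros z Hz.
replace (Cmod z * Cmod (N2 z)) with (Cmod (d0 * N z - n0 * D z)).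
2:{ rewrite (HFN2 z Hz), <- Cmod_mult. f_equal. unfold n0, d0. ring. }
assert (Hm := Cmod_mobius d0 n0 (N z) (D z)).
apply Rsqr_incr_0; [|apply Cmod_ge_0|apply Cmod_ge_0].
rewrite !Rsqr_pow2.
assert (Hsq : 0 <= (Cmod d0 ^ 2 - Cmod n0 ^ 2) * (Cmod (D z) ^ 2 - Cmod (N z) ^ 2)).
{ apply Rmult_le_pos.
  - assert (Cmod n0 ^ 2 <= Cmod d0 ^ 2)
      by (apply pow_incr; split; [apply Cmod_ge_0|lra]). lra.
  - assert (Cmod (N z) ^ 2 <= Cmod (D z) ^ 2)
      by (apply pow_incr; split; [apply Cmod_ge_0|apply Hle; exact Hz]). lra. }
lra.
Qed.

(** Schur steps need a strict inequality at [0].  They are applied to [t n]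
    with [t < 1], and this lemma lets [t] tend to [1]. *)
Lemma le_of_scaled_le (X A B : R) :
  0 <= X -> 0 <= B -> (forall t, 0 < t < 1 -> t * X <= A - t ^ 2 * B) -> X <= A - B.
Proof.
intros HX HB H. apply Rnot_lt_le; intros Hlt.
set (g := X - (A - B)). set (L := X + 2 * B + 1).
assert (HL : 0 < L) by (unfold L; lra).
assert (Hg : 0 < g) by (unfold g; lra).
set (e := Rmin (1 / 2) (g / (2 * L))).
assert (He : 0 < e) by (unfold e; apply Rmin_pos; [lra|apply Rdiv_lt_0_compat; lra]).
assert (He1 : e <= 1 / 2) by apply Rmin_l.
assert (He2 : e * L <= g / 2).
{ replace (g / 2) with (g / (2 * L) * L) by (field; lra).
  apply Rmult_le_compat_r; [lra|apply Rmin_r]. }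
clearbody e. specialize (H (1 - e)). unfold L, g in *. nra.
Qed.

(** The Schwarz-Pick inequality [|phi'(0)| <= 1 - |phi(0)|^2] for [phi = N / D],
    multiplied by [|d0|^2]: it says that the pair after one Schur step is
    still bounded by [1] at the origin. *)
Lemma schwarz_pick_0 (n d : nat -> C) :
  schur_pair n d ->
  Cmod (d 0%nat * n 1%nat - n 0%nat * d 1%nat) <= Cmod (d 0%nat) ^ 2 - Cmod (n 0%nat) ^ 2.
Proof.
intros H. apply le_of_scaled_le; [apply Cmod_ge_0|apply pow_le, Cmod_ge_0|].
intros t Ht. destruct (schur_pair_0 n d H) as [Hd0 Hn0].
apply Cmod_gt_0 in Hd0.
assert (Hlt : Cmod (RtoC t * n 0%nat) < Cmod (d 0%nat)).
{ rewrite Cmod_mult, Cmod_R, Rabs_pos_eq by lra.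
  generalize (Cmod_ge_0 (n 0%nat)); nra. }
assert (Ht' : 0 <= t <= 1) by lra.
destruct (schur_pair_0 _ _ (schur_step _ _ (schur_pair_scal n d t Ht' H) Hlt)) as [_ Hle].
cbv beta in Hle.
match type of Hle with Cmod ?x <= Cmod ?y =>
  replace x with (RtoC t * (d 0%nat * n 1%nat - n 0%nat * d 1%nat))%C in Hle by ring;
  replace y with (RtoC (Cmod (d 0%nat) ^ 2 - t ^ 2 * Cmod (n 0%nat) ^ 2)) in Hle
end.
- rewrite Cmod_mult, !Cmod_R, (Rabs_pos_eq t) in Hle by lra.
  rewrite Rabs_pos_eq in Hle; [exact Hle|].
  rewrite Cmod_mult, Cmod_R, Rabs_pos_eq in Hlt by lra.
  assert ((t * Cmod (n 0%nat)) ^ 2 <= Cmod (d 0%nat) ^ 2).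
  { apply pow_incr; split; [apply Rmult_le_pos; [lra|apply Cmod_ge_0]|lra]. }
  rewrite Rpow_mult_distr in H0. lra.
- rewrite RtoC_minus, RtoC_mult, !Cmod2_conj, RtoC_pow, Cmult_conj.
  replace (Cconj (RtoC t)) with (RtoC t) by (apply injective_projections; simpl; ring).
  ring.
Qed.

Lemma Cconj_RtoC (x : R) : Cconj (RtoC x) = RtoC x.
Proof. apply injective_projections; simpl; ring. Qed.

(** The hypotheses say that [b0 + b1 z + b2 z^2] begins the expansion of [N / D].
    The first bound is [schwarz_pick_0].  For the second, write
    [s = 1 - |b0|^2]; [schwarz_pick_0] after one Schur step reads
    [|s b2 + conj b0 b1^2| <= s^2 - |b1|^2], and [|b0| <= 1] lets the two terms
    in [b1] cancel. *)
Lemma schur_coef_bounds (n d : nat -> C) (b0 b1 b2 : C) :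
  schur_pair n d ->
  n 0%nat = (b0 * d 0%nat)%C ->
  n 1%nat = (b0 * d 1%nat + b1 * d 0%nat)%C ->
  n 2%nat = (b0 * d 2%nat + b1 * d 1%nat + b2 * d 0%nat)%C ->
  Cmod b1 <= 1 - Cmod b0 ^ 2 /\ Cmod b2 <= 1 - Cmod b0 ^ 2.
Proof.
intros H Hn0 Hn1 Hn2.
destruct (schur_pair_0 n d H) as [Hd0 Hle0].
assert (Hd := proj1 (Cmod_gt_0 _) Hd0).
set (d0 := d 0%nat) in *. set (m := Cmod d0) in *.
assert (Hb0 : Cmod b0 <= 1).
{ rewrite Hn0, Cmod_mult in Hle0. fold m in Hle0.
  apply (Rmult_le_reg_r m); lra. }
assert (Hb00 := Cmod_ge_0 b0).
assert (Hm2 : 0 < m ^ 2) by (apply pow_lt; exact Hd).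
split.
- assert (Hsp := schwarz_pick_0 n d H). fold d0 m in Hsp.
  rewrite Hn1, Hn0 in Hsp.
  replace (d0 * (b0 * d 1%nat + b1 * d0) - b0 * d0 * d 1%nat)%C
    with (d0 ^ 2 * b1)%C in Hsp by ring.
  rewrite !Cmod_mult, Cmod_pow in Hsp. fold m in Hsp.
  apply (Rmult_le_reg_l (m ^ 2)); [exact Hm2|].
  rewrite Rpow_mult_distr in Hsp. lra.
- apply le_of_scaled_le; [apply Cmod_ge_0|apply pow_le, Cmod_ge_0|].
  intros t Ht. assert (Ht' : 0 <= t <= 1) by lra.
  assert (Htb : t * Cmod b0 < 1) by nra.
  assert (Hlt : Cmod (RtoC t * n 0%nat) < Cmod d0).
  { rewrite Hn0, !Cmod_mult, Cmod_R, Rabs_pos_eq by lra. fold m.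
    rewrite <- Rmult_assoc. nra. }
  assert (Hsp := schwarz_pick_0 _ _ (schur_step _ _ (schur_pair_scal n d t Ht' H) Hlt)).
  cbv beta in Hsp. fold d0 in Hsp.
  set (s := 1 - t ^ 2 * Cmod b0 ^ 2).
  assert (Hs : 0 < s).
  { unfold s. assert (0 <= t * Cmod b0) by (apply Rmult_le_pos; lra).
    rewrite <- Rpow_mult_distr. nra. }
  assert (HsC : (Cconj d0 * d0 - Cconj (RtoC t * n 0%nat) * (RtoC t * n 0%nat))%C
                = RtoC (m ^ 2 * s)).
  { unfold s, m. rewrite Hn0, RtoC_mult, RtoC_minus, RtoC_mult, !Cmod2_conj, RtoC_pow.
    rewrite !Cmult_conj, Cconj_RtoC. ring. }
  rewrite HsC in Hsp.
  assert (Hn20 : (d0 * (RtoC t * n 1%nat) - RtoC t * n 0%nat * d 1%nat)%C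
                 = (d0 ^ 2 * (RtoC t * b1))%C).
  { rewrite Hn1, Hn0. ring. }
  rewrite Hn20 in Hsp.
  rewrite Hn2, Hn1, Hn0 in Hsp. rewrite !Cmult_conj, Cconj_RtoC in Hsp.
  match type of Hsp with Cmod ?x <= _ =>
    replace x with (RtoC (m ^ 2) * d0 ^ 2 *
      (RtoC (t * s) * b2 + RtoC (t ^ 3) * Cconj b0 * b1 ^ 2))%C in Hsp
  end.
  2:{ unfold s, m. rewrite !RtoC_mult, !RtoC_minus, RtoC_mult, !RtoC_pow,
        <- !RtoC_pow, !Cmod2_conj, !RtoC_pow. ring. }
  rewrite !Cmod_mult, !Cmod_pow, !Cmod_R in Hsp. fold m in Hsp.
  rewrite (Rabs_pos_eq (m ^ 2)), (Rabs_pos_eq (m ^ 2 * s)), (Rabs_pos_eq t) in Hsp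
    by (try apply Rmult_le_pos; lra).
  set (E := Cmod (RtoC (t * s) * b2 + RtoC (t ^ 3) * Cconj b0 * b1 ^ 2)) in *.
  assert (HE : E <= s ^ 2 - t ^ 2 * Cmod b1 ^ 2).
  { apply (Rmult_le_reg_l (m ^ 2 * m ^ 2)); [apply Rmult_lt_0_compat; lra|].
    eapply Rle_trans; [exact Hsp|]. right. ring. }
  assert (Htri : t * s * Cmod b2 <= E + t ^ 3 * Cmod b0 * Cmod b1 ^ 2).
  { replace (t * s * Cmod b2) with (Cmod (RtoC (t * s) * b2)).
    2:{ rewrite Cmod_mult, Cmod_R, Rabs_pos_eq; [ring|apply Rmult_le_pos; lra]. }
    replace (t ^ 3 * Cmod b0 * Cmod b1 ^ 2)
      with (Cmod (RtoC (t ^ 3) * Cconj b0 * b1 ^ 2)).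
    2:{ rewrite !Cmod_mult, Cmod_pow, Cmod_conj, Cmod_R, Rabs_pos_eq; [ring|].
        apply pow_le; lra. }
    replace (RtoC (t * s) * b2)%C with
      ((RtoC (t * s) * b2 + RtoC (t ^ 3) * Cconj b0 * b1 ^ 2)
       + - (RtoC (t ^ 3) * Cconj b0 * b1 ^ 2))%C by ring.
    eapply Rle_trans; [apply Cmod_triangle|]. rewrite Cmod_opp. unfold E; lra. }
  assert (Hb1 : 0 <= t ^ 2 * Cmod b1 ^ 2)
    by (apply Rmult_le_pos; apply pow_le; [lra|apply Cmod_ge_0]).
  assert (Hlast : t ^ 3 * Cmod b0 * Cmod b1 ^ 2 <= t ^ 2 * Cmod b1 ^ 2).
  { replace (t ^ 3 * Cmod b0 * Cmod b1 ^ 2)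
      with (t * Cmod b0 * (t ^ 2 * Cmod b1 ^ 2)) by ring. nra. }
  fold s. apply (Rmult_le_reg_l s); [exact Hs|]. nra.
Qed.

(** * The bound for starlike functions *)

Lemma Cmod_minus_1_lt_plus_1 (p : C) : 0 < Re p -> Cmod (p - 1) < Cmod (p + 1).
Proof.
intros Hp. apply Rsqr_incrst_0; [|apply Cmod_ge_0|apply Cmod_ge_0].
rewrite !Rsqr_pow2, !Cmod2_alt. destruct p as [x y]; simpl in *. nra.
Qed.

(** With [f = z G], the function [w = (z f' - f) / (z f' + f)] equals [z N / D]
    for [D = f' + G] and [z N = f' - G].  The coefficients [n] of [N] and [d] of
    [D] are those listed, and [schwarz_quotient] removes the factor [z]. *)
Lemma starlike_schur_pair (f : C -> C) (a : nat -> C) :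
  starlike f -> expansion_in_disk f a ->
  a 1%nat = 1 /\
  schur_pair (fun k => RtoC (INR (S k)) * a (S (S k)))%C
             (fun k => RtoC (INR (S (S k))) * a (S k))%C.
Proof.
intros [[_ (a' & Ha0' & Ha1' & Hf')] Hstar] Hf.
destruct (expansion_derive f a Hf) as [Hdf _].
destruct (expansion_derive f a' Hf') as [Hdf' _].
assert (Ha0 : a 0%nat = 0).
{ rewrite <- (expansion_at_0 f a Hf), (expansion_at_0 f a' Hf'). exact Ha0'. }
assert (Ha1 : a 1%nat = 1).
{ assert (H := expansion_at_0 _ _ Hdf). rewrite (expansion_at_0 _ _ Hdf') in H.
  unfold deriv_coef in H. rewrite Ha1' in H. simpl in H.
  rewrite !Cmult_1_l in H. symmetry; exact H. }
split; [exact Ha1|].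
destruct (expansion_shift f a Hf) as (G & HG & HfG).
assert (HfG' : forall z, in_disk z -> f z = (z * G z)%C).
{ intros z Hz; rewrite (HfG z Hz), Ha0; ring. }
assert (HS := expansion_lin _ _ _ _ 1 1 Hdf HG).
assert (HM := expansion_lin _ _ _ _ 1 (-(1))%C Hdf HG).
destruct (expansion_shift _ _ HM) as (N & HN & HMN).
assert (HMN' : forall z, in_disk z -> (C_derive f z - G z)%C = (z * N z)%C).
{ intros z Hz. transitivity (1 * C_derive f z + -(1) * G z)%C; [ring|].
  rewrite (HMN z Hz). unfold deriv_coef; simpl. ring. }
set (D := fun z => (1 * C_derive f z + 1 * G z)%C) in *.
assert (Hlt : forall z, in_disk z -> Cmod z * Cmod (N z) < Cmod (D z)).
{ intros z Hz. rewrite <- Cmod_mult, <- (HMN' z Hz). unfold D.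
  destruct (Hstar z Hz) as [Hfz Hre]. unfold log_derivative_quotient in Hre.
  destruct (Ceq_dec z 0) as [Hz0|Hz0].
  - subst z. rewrite (expansion_at_0 _ _ Hdf), (expansion_at_0 _ _ HG).
    unfold deriv_coef. rewrite Ha1. simpl INR.
    replace (RtoC 1 * 1 - 1)%C with (RtoC 0) by ring.
    replace (1 * (1 * 1) + 1 * 1)%C with (RtoC 2)
      by (apply injective_projections; simpl; ring).
    rewrite !Cmod_R, !Rabs_pos_eq; lra.
  - specialize (Hfz Hz0). rewrite (HfG' z Hz) in Hfz, Hre.
    assert (HGz : G z <> 0) by (intros E; apply Hfz; rewrite E; ring).
    replace (z * C_derive f z / (z * G z))%C with (C_derive f z / G z)%C in Hre
      by (field; split; assumption).
    apply Cmod_minus_1_lt_plus_1 in Hre.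
    assert (HGm := proj1 (Cmod_gt_0 _) HGz).
    replace (C_derive f z - G z)%C with (G z * (C_derive f z / G z - 1))%C
      by (field; assumption).
    replace (1 * C_derive f z + 1 * G z)%C with (G z * (C_derive f z / G z + 1))%C
      by (field; assumption).
    rewrite !Cmod_mult. apply Rmult_lt_compat_l; assumption. }
assert (HD0 : forall z, in_disk z -> D z <> 0).
{ intros z Hz. apply Cmod_gt_0. eapply Rle_lt_trans; [|apply (Hlt z Hz)].
  apply Rmult_le_pos; apply Cmod_ge_0. }
exists N, D. split; [|split; [|split; [exact HD0|]]].
- intros z Hz. eapply is_sum_ext; [|apply HN; exact Hz].
  intros k. unfold deriv_coef. cbv beta. rewrite !S_INR, !RtoC_plus. ring.
- intros z Hz. eapply is_sum_ext; [|apply HS; exact Hz].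
  intros k. unfold deriv_coef. cbv beta. rewrite !S_INR, !RtoC_plus. ring.
- apply (schwarz_quotient N D _ _ HN HS HD0).
  intros z Hz; left; apply Hlt; exact Hz.
Qed.

(** [b0], [b1], [b2] below solve the triangular system of [schur_coef_bounds] for
    the pair of [starlike_schur_pair]; there [d0 = 2], [d1 = 3 a2], [d2 = 4 a3] and
    [n0 = a2], [n1 = 2 a3], [n2 = 3 a4]. *)
Lemma starlike_bound (f : C -> C) (a : nat -> C) :
  starlike f -> expansion_in_disk f a ->
  Cmod (a 2%nat * a 3%nat - a 4%nat) <= 2.
Proof.
intros Hf Ha. destruct (starlike_schur_pair f a Hf Ha) as [Ha1 Hpair].
set (b0 := (a 2%nat / 2)%C).
set (b1 := (a 3%nat - 3 / 4 * a 2%nat ^ 2)%C).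
set (b2 := ((3 * a 4%nat - 5 * a 2%nat * a 3%nat + 9 / 4 * a 2%nat ^ 3) / 2)%C).
assert (H2 : RtoC 2 = (1 + 1)%C) by (apply injective_projections; simpl; ring).
assert (H3 : RtoC 3 = (1 + 2)%C) by (apply injective_projections; simpl; ring).
assert (H4 : RtoC 4 = (2 + 2)%C) by (apply injective_projections; simpl; ring).
assert (H5 : RtoC 5 = (2 + 3)%C) by (apply injective_projections; simpl; ring).
assert (N2 : (1 + 1)%C <> 0) by (rewrite <- H2; intros E; apply RtoC_inj in E; lra).
assert (N3 : (1 + (1 + 1))%C <> 0) by (rewrite <- H2, <- H3; intros E; apply RtoC_inj in E; lra).
assert (N4 : (1 + 1 + (1 + 1))%C <> 0) by (rewrite <- H2, <- H4; intros E; apply RtoC_inj in E; lra).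
destruct (schur_coef_bounds _ _ b0 b1 b2 Hpair) as [Hb1 Hb2];
  [cbv beta; rewrite Ha1; unfold b0, b1, b2; simpl INR;
   rewrite ?RtoC_plus, ?H5, ?H4, ?H3, ?H2; field; auto..|].
replace (a 2%nat * a 3%nat - a 4%nat)%C
  with (RtoC (2 / 3) * (3 * b0 ^ 3 + - (2 * b0 * b1) + - b2))%C
  by (unfold b0, b1, b2; rewrite RtoC_div by lra; rewrite ?H5, ?H4, ?H3, ?H2; field; auto).
rewrite Cmod_mult, Cmod_R, Rabs_pos_eq by lra.
assert (Ht1 := Cmod_triangle (3 * b0 ^ 3 + - (2 * b0 * b1)) (- b2)).
assert (Ht2 := Cmod_triangle (3 * b0 ^ 3) (- (2 * b0 * b1))).
rewrite !Cmod_opp, !Cmod_mult, Cmod_pow, !Cmod_R, !Rabs_pos_eq in Ht2 by lra.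
rewrite Cmod_opp in Ht1.
assert (P0 := Cmod_ge_0 b0). assert (P1 := Cmod_ge_0 b1).
set (s := Cmod b0) in *.
assert (Hs : s <= 1) by nra.
assert (s * Cmod b1 <= s * (1 - s ^ 2)) by (apply Rmult_le_compat_l; lra).
assert (3 * s ^ 3 + 2 * (s * (1 - s ^ 2)) + (1 - s ^ 2) <= 3) by nra.
lra.
Qed.

(** * The Koebe function *)

Lemma one_minus_disk_neq_0 (z : C) : in_disk z -> (1 - z)%C <> 0.
Proof.
intros Hz E. unfold in_disk in Hz.
replace z with (RtoC 1) in Hz.
- rewrite Cmod_1 in Hz; lra.
- replace z with (1 - (1 - z))%C by ring. rewrite E. ring.
Qed.

Lemma geometric_expansion : expansion_in_disk (fun z => / (1 - z))%C (fun _ => RtoC 1).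
Proof.
assert (H : expansion_in_disk (disk_sum (fun _ => RtoC 1)) (fun _ => RtoC 1)).
{ apply Cauchy_bounded_expansion. intros rho Hrho. exists 1. intros n.
  rewrite Cmod_1, Rmult_1_l, <- (pow1 n). apply pow_incr; lra. }
intros z Hz. assert (Hn := one_minus_disk_neq_0 z Hz).
set (s := disk_sum (fun _ => RtoC 1) z).
assert (Hs : s = (1 + z * s)%C).
{ apply (is_sum_unique (fun _ => RtoC 1) z); [apply H; exact Hz|].
  apply (is_sum_unshift (fun _ => RtoC 1)), H, Hz. }
replace (/ (1 - z))%C with s; [apply H; exact Hz|].
replace s with ((s - z * s) / (1 - z))%C by (field; exact Hn).
rewrite Hs at 1. field. exact Hn.
Qed.

Lemma RtoC_S (n : nat) : RtoC (INR (S n)) = (RtoC (INR n) + 1)%C.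
Proof. rewrite S_INR, RtoC_plus; reflexivity. Qed.

(** The derived geometric series has coefficients [n + 1], and comparing it with
    its own shift determines its sum; one more shift gives [koebe]. *)
Lemma koebe_expansion : expansion_in_disk koebe (fun n => RtoC (INR n)).
Proof.
destruct (expansion_derive _ _ geometric_expansion) as [H _].
set (S1 := C_derive _) in H.
intros z Hz. assert (Hn := one_minus_disk_neq_0 z Hz).
assert (H1 : is_sum (fun n => RtoC (INR (S n))) z (S1 z)).
{ apply (is_sum_ext (deriv_coef (fun _ => RtoC 1))); [|apply H; exact Hz].
  intros n; unfold deriv_coef; ring. }
assert (Hs : S1 z = (1 + z * (S1 z + / (1 - z)))%C).
{ apply (is_sum_unique (fun n => RtoC (INR (S n))) z); [exact H1|].
  apply (is_sum_unshift (fun n => RtoC (INR (S n)))).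
  apply (is_sum_ext (fun n => RtoC (INR (S n)) + 1)%C).
  { intros n. rewrite (RtoC_S (S n)); reflexivity. }
  apply (is_pseries_plus (K := C_AbsRing) (V := C_NormedModule)
    (fun n => RtoC (INR (S n))) (fun _ => RtoC 1) z).
  - exact H1.
  - apply geometric_expansion; exact Hz. }
replace (koebe z) with (RtoC (INR 0) + z * S1 z)%C.
- apply (is_sum_unshift (fun n => RtoC (INR n))). exact H1.
- unfold koebe. simpl INR.
  replace (S1 z) with ((S1 z - z * S1 z) / (1 - z))%C by (field; exact Hn).
  rewrite Hs at 1. field. exact Hn.
Qed.

(** The derived series has coefficients [(n + 1)^2].  Its shift differs from it
    by [2 n + 3], a combination of the two series already summed, which yields a
    linear equation for the sum. *)
Lemma koebe_derive (z : C) :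
  in_disk z -> C_derive koebe z = ((1 + z) / (1 - z) ^ 3)%C.
Proof.
intros Hz. assert (Hn := one_minus_disk_neq_0 z Hz).
destruct (expansion_derive _ _ koebe_expansion) as [H _].
assert (H0 := geometric_expansion z Hz). fold (is_sum (fun _ => RtoC 1) z (/ (1 - z))) in H0.
assert (Hk : is_sum (fun n => RtoC (INR n)) z (koebe z)) by exact (koebe_expansion z Hz).
assert (H2' : RtoC 2 = (1 + 1)%C) by (apply injective_projections; simpl; ring).
assert (H3' : RtoC 3 = (1 + 1 + 1)%C) by (apply injective_projections; simpl; ring).
set (s := C_derive koebe z).
assert (H2 : is_sum (deriv_coef (fun n => RtoC (INR n))) z s) by exact (H z Hz).
assert (Hs : s = (1 + z * (s + (2 * koebe z + 3 * / (1 - z))))%C).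
{ apply (is_sum_unique _ _ _ _ H2).
  replace (RtoC 1) with (deriv_coef (fun n => RtoC (INR n)) 0) at 1
    by (unfold deriv_coef; simpl; ring).
  apply is_sum_unshift.
  apply (is_sum_ext (fun n => deriv_coef (fun n => RtoC (INR n)) n
                              + (2 * RtoC (INR n) + 3 * 1))%C).
  { intros n. unfold deriv_coef.
    rewrite !RtoC_S, H2', H3'. ring. }
  apply (is_pseries_plus (K := C_AbsRing) (V := C_NormedModule)
    (deriv_coef (fun n => RtoC (INR n))) (fun n => 2 * RtoC (INR n) + 3 * 1)%C z).
  - exact H2.
  - exact (expansion_lin _ _ _ _ 2 3 koebe_expansion geometric_expansion z Hz). }
replace s with ((s - z * s) / (1 - z))%C by (field; exact Hn).
rewrite Hs at 1. unfold koebe.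
rewrite H2', H3'. field. exact Hn.
Qed.

Lemma Re_cayley_pos (z : C) : in_disk z -> 0 < Re ((1 + z) / (1 - z))%C.
Proof.
intros Hz. assert (Hn := one_minus_disk_neq_0 z Hz).
assert (Hm : 0 < Cmod (1 - z) ^ 2) by (apply pow_lt, Cmod_gt_0, Hn).
assert (HC : RtoC (Cmod (1 - z) ^ 2) <> 0) by (intros E; apply RtoC_inj in E; lra).
rewrite Cmod2_conj in HC.
assert (Hc : Cconj (1 - z) <> 0) by (intros E; apply HC; rewrite E; ring).
replace ((1 + z) / (1 - z))%C
  with (RtoC (/ Cmod (1 - z) ^ 2) * ((1 + z) * Cconj (1 - z)))%C.
2:{ rewrite RtoC_inv, Cmod2_conj by lra. field. split; assumption. }
assert (Hre : Re ((1 + z) * Cconj (1 - z)) = 1 - Cmod z ^ 2).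
{ rewrite Cmod2_alt. destruct z as [x y]; simpl. ring. }
replace (Re (RtoC (/ Cmod (1 - z) ^ 2) * ((1 + z) * Cconj (1 - z))))
  with (/ Cmod (1 - z) ^ 2 * Re ((1 + z) * Cconj (1 - z)))
  by (unfold Re; simpl; ring).
rewrite Hre. apply Rmult_lt_0_compat; [apply Rinv_0_lt_compat; exact Hm|].
unfold in_disk in Hz. generalize (Cmod_ge_0 z); nra.
Qed.

Lemma koebe_starlike : starlike koebe.
Proof.
destruct (expansion_derive _ _ koebe_expansion) as [_ Hd].
split; [split|].
- intros z Hz. exists (C_derive koebe z). apply Hd; exact Hz.
- exists (fun n => RtoC (INR n)). split; [|split]; [reflexivity|reflexivity|].
  exact koebe_expansion.
- intros z Hz. assert (Hn := one_minus_disk_neq_0 z Hz).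
  assert (Hkz : z <> 0 -> koebe z <> 0).
  { intros Hz0. unfold koebe, Cdiv. apply Cmult_neq_0; [exact Hz0|].
    rewrite <- Cpow_inv by exact Hn. apply Cpow_nz.
    intros E. apply C1_nz. rewrite <- (Cinv_r _ Hn), E. ring. }
  split; [exact Hkz|]. unfold log_derivative_quotient.
  destruct (Ceq_dec z 0) as [Hz0|Hz0]; [simpl; lra|].
  rewrite (koebe_derive z Hz).
  replace (z * ((1 + z) / (1 - z) ^ 3) / koebe z)%C with ((1 + z) / (1 - z))%C.
  + apply Re_cayley_pos; exact Hz.
  + unfold koebe. field. split; assumption.
Qed.

Theorem theorem3p3 :
  (forall (f : C -> C) (a : nat -> C),
      starlike f -> expansion_in_disk f a ->
      Cmod (a 2%nat * a 3%nat - a 4%nat)%C <= 2) /\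
  (starlike koebe /\
   exists a : nat -> C,
     expansion_in_disk koebe a /\
     Cmod (a 2%nat * a 3%nat - a 4%nat)%C = 2).
Proof.
split; [exact starlike_bound|split; [exact koebe_starlike|]].
exists (fun n => RtoC (INR n)); split; [exact koebe_expansion|].
rewrite <- RtoC_mult, <- RtoC_minus, Cmod_R. simpl INR.
replace ((1 + 1) * (1 + 1 + 1) - (1 + 1 + 1 + 1)) with 2 by ring.
apply Rabs_pos_eq; lra.
Qed.
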